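(* Let $(A,p_+)$ be a Rota-Baxter algebra with $A$ a unital associative algebra over a commutative field $k$, let $p_-=\mathrm{Id}-p_+$, $A_\pm=\operatorname{Im}p_\pm$, and let $j\in\mathcal U(A^{\mathrm{st}},A)$ be the linear map with $j(\emptyset)=1_A$, $j(a_1)=a_1$, and $j(a_1\otimes\cdots\otimes a_r)=0$ for $r\ge2$. The Birkhoff-Rota-Baxter decomposition of $j$, i.e. the unique pair $(j_+,j_-)\in\mathcal U(A^{\mathrm{st}},A_+)\times\mathcal U(A^{\mathrm{st}},A_-)$ such that $$j_-\ast j=j_+,$$ is given by the formula: for $r\ge1$ and $\mathbf a=a_1\otimes\cdots\otimes a_r\in(A^{\mathrm{st}})'$, $$j_+(\mathbf a)=p_+(\bar j(\mathbf a))=(-1)^{r-1}p_+\bigl(p_-(\ldots(p_-(a_1)a_2)\ldots a_{r-1})a_r\bigr),$$ $$j_-(\mathbf a)=-p_-(\bar j(\mathbf a))=(-1)^{r}p_-\bigl(p_-(\ldots(p_-(a_1)a_2)\ldots a_{r-1})a_r\bigr).$$ (For $r=1$ these read $j_+(a_1)=p_+(a_1)$, $j_-(a_1)=-p_-(a_1)$.) Moreover, if $A$ is commutative, then $\mathcal C(A^{\mathrm{st}},A)$ is a group for the convolution product $\ast$, and $j_+$ and $j_-$ are characters.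
   Context: All vector spaces, algebras and tensor products are over a commutative field $k$; algebras are associative. Rota-Baxter algebra. $(A,p_+)$ is a Rota-Baxter algebra if $A$ is a unital algebra and $p_+:A\to A$ is a linear idempotent with $p_+(x)p_+(y)+p_+(xy)=p_+(xp_+(y))+p_+(p_+(x)y)$ for all $x,y\in A$. Then $p_-=\mathrm{Id}-p_+$ satisfies the same identity, $A=A_+\oplus A_-$ with $A_\pm=\operatorname{Im}p_\pm$, and $A_\pm$ are (not necessarily unital) subalgebras. Stuffle Hopf algebra. $A^{\mathrm{st}}=\bigoplus_{n\ge0}A^{\mathrm{st}}_{(n)}$ with $A^{\mathrm{st}}_{(0)}=k\emptyset$ and $A^{\mathrm{st}}_{(n)}=A^{\otimes n}$ for $n\ge1$; $(A^{\mathrm{st}})'=\bigoplus_{n\ge1}A^{\mathrm{st}}_{(n)}$. The symbol $\otimes$ between letters is the internal (concatenation) tensor product, and $\otimes_{\mathrm{st}}$ denotes the tensor product of elements of $A^{\mathrm{st}}$. The product $m_{\mathrm{st}}$ (stuffle, or quasi-shuffle) has unit $\emptyset$ and is defined recursively, for $\mathbf a=a_1\otimes\cdots\otimes a_r$, $\mathbf b=b_1\otimes\cdots\otimes b_s$ ($r,s\ge1$), $\tilde{\mathbf a}=a_1\otimes\cdots\otimes a_{r-1}$ ($=\emptyset$ if $r=1$), $\tilde{\mathbf b}=b_1\otimes\cdots\otimes b_{s-1}$ ($=\emptyset$ if $s=1$), by $$m_{\mathrm{st}}(\mathbf a\otimes_{\mathrm{st}}\mathbf b)=m_{\mathrm{st}}(\tilde{\mathbf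 a}\otimes_{\mathrm{st}}\mathbf b)\otimes a_r+m_{\mathrm{st}}(\mathbf a\otimes_{\mathrm{st}}\tilde{\mathbf b})\otimes b_s+m_{\mathrm{st}}(\tilde{\mathbf a}\otimes_{\mathrm{st}}\tilde{\mathbf b})\otimes a_rb_s.$$ The counit is $\eta_{\mathrm{st}}(\emptyset)=1$, $\eta_{\mathrm{st}}=0$ on $(A^{\mathrm{st}})'$. The coproduct is deconcatenation: $\Delta_{\mathrm{st}}(\emptyset)=\emptyset\otimes_{\mathrm{st}}\emptyset$, $\Delta_{\mathrm{st}}(\mathbf a)=\mathbf a\otimes_{\mathrm{st}}\emptyset+\emptyset\otimes_{\mathrm{st}}\mathbf a+\Delta'_{\mathrm{st}}(\mathbf a)$ with $\Delta'_{\mathrm{st}}(a_1\otimes\cdots\otimes a_s)=\sum_{r=1}^{s-1}(a_1\otimes\cdots\otimes a_r)\otimes_{\mathrm{st}}(a_{r+1}\otimes\cdots\otimes a_s)$. With these, $A^{\mathrm{st}}$ is a connected Hopf algebra. Groups of maps. $\mathcal U(A^{\mathrm{st}},A)$ is the set of linear maps $f:A^{\mathrm{st}}\to A$ with $f(\emptyset)=1_A$; it is a group under the convolution $f\ast g=m_A\circ(f\otimes g)\circ\Delta_{\mathrm{st}}$ ($m_A$ the product of $A$), with unit $u_A\circ\eta_{\mathrm{st}}$, where $u_A(1)=1_A$. For a subalgebra $B\subset A$ (possibly non-unital), $\mathcal U(A^{\mathrm{st}},B)=\{f\in\mathcal U(A^{\mathrm{st}},A): f((A^{\mathrm{st}})')\subset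 B\}$. $\mathcal C(A^{\mathrm{st}},A)\subset\mathcal U(A^{\mathrm{st}},A)$ is the subset of characters, i.e. of unital algebra morphisms $(A^{\mathrm{st}},m_{\mathrm{st}})\to A$. Bogoliubov map. $\bar j\in\mathcal U(A^{\mathrm{st}},A)$ is defined by $\bar j(\emptyset)=1_A$ and, recursively on length, $\bar j(\mathbf a)=j(\mathbf a)-m_A\circ(p_-\otimes\mathrm{Id})\circ(\bar j\otimes j)\circ\Delta'_{\mathrm{st}}(\mathbf a)$ for $\mathbf a\in(A^{\mathrm{st}})'$. *)

(* Defs.v *)
From HB Require Import structures.
From mathcomp Require Import all_boot all_algebra.
From mathcomp Require Import boolp classical_sets.
From mathcomp.finmap Require Import finmap.
From mathcomp.multinomials Require Import monalg.

Set Implicit Arguments.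
Unset Strict Implicit.
Unset Printing Implicit Defensive.

Import GRing.Theory.
Local Open Scope ring_scope.
Local Open Scope quotient_scope.

Lemma linear_ext (R : nzRingType) (U V : lmodType R) (f g : {linear U -> V}) :
  f =1 g -> f = g.
Proof.
case: f => [f [[f1] [f2]]]; case: g => [g [[g1] [g2]]] /= /funext fg.
subst g; congr (GRing.Linear.Pack (GRing.Linear.Class _ _)).
  by congr GRing.isNmodMorphism.Axioms_; apply: Prop_irrelevance.
by congr GRing.isScalable.Axioms_; apply: Prop_irrelevance.
Qed.

Section Span.
Variables (R : nzRingType) (V : lmodType R).

Inductive lspan (S : set V) : set V :=
| lspan0 : lspan S 0
| lspan_cons c x y : S x -> lspan S y -> lspan S (c *: x + y).

Lemma lspanP S c x y : lspan S x -> lspan S y -> lspan S (c *: x + y).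
Proof.
move=> Sx Sy; elim: Sx => [|d z t Sz _ IH]; first by rewrite scaler0 add0r.
by rewrite scalerDr scalerA -addrA; apply: lspan_cons.
Qed.

Lemma lspan_sub S x : S x -> lspan S x.
Proof. by move=> Sx; rewrite -[x]scale1r -[_ *: x]addr0; do 2?constructor. Qed.

End Span.

Section Presented.
Variables (k : fieldType) (X : choiceType) (rels : set {malg k[X]}).

Definition relspan : {pred {malg k[X]}} := fun g => `[< lspan rels g >].

Fact relspan_zmod_closed : zmod_closed relspan.
Proof.
split=> [|x y /asboolP Sx /asboolP Sy]; apply/asboolP; first exact: lspan0.
by rewrite addrC -scaleN1r; apply: lspanP.
Qed.

HB.instance Definition _ :=
  GRing.isZmodClosed.Build {malg k[X]} relspan relspan_zmod_closed.

(* The free k-module on X modulo the submodule spanned by rels. Membership in *)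
(* that submodule is not decidable in general, whence the classical boolean.  *)
Definition presented := Quotient.quot relspan.
HB.instance Definition _ := GRing.Zmodule.on presented.
HB.instance Definition _ := EqQuotient.on presented.

Fact relspan_repr g : lspan rels (g - repr (\pi_presented g)).
Proof.
apply/asboolP; change (g - repr (\pi_presented g) \in relspan).
by rewrite Quotient.idealrBE reprK.
Qed.

Definition presented_scale (c : k) := lift_op1 presented ( *:%R c).

Fact pi_presented_scale c :
  {morph \pi_presented : x / c *: x >-> presented_scale c x}.
Proof.
move=> x; unlock presented_scale; apply/eqP; rewrite -Quotient.idealrBE.
rewrite -scalerBr; apply/asboolP; rewrite -[_ *: _]addr0.
by apply: lspanP; [exact: relspan_repr | exact: lspan0].
Qed.

Fact presented_piD (x y : {malg k[X]}) :
  \pi_presented (x + y) = \pi_presented x + \pi_presented y.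
Proof. exact: (Quotient.pi_add relspan). Qed.

Fact presented_pi0 : \pi_presented 0 = 0.
Proof. by apply: (addrI (\pi_presented 0)); rewrite -presented_piD !addr0. Qed.

Fact presented_scaleA a b v :
  presented_scale a (presented_scale b v) = presented_scale (a * b) v.
Proof. by rewrite -[v]reprK -!pi_presented_scale scalerA. Qed.
Fact presented_scale1 : left_id 1 presented_scale.
Proof. by move=> v; rewrite -[v]reprK -pi_presented_scale scale1r. Qed.
Fact presented_scaleDr : right_distributive presented_scale +%R.
Proof.
move=> a u v; rewrite -[u]reprK -[v]reprK -presented_piD -!pi_presented_scale.
by rewrite -presented_piD scalerDr.
Qed.
Fact presented_scaleDl v : {morph presented_scale^~ v : a b / a + b}.
Proof.
by move=> a b; rewrite -[v]reprK -!pi_presented_scale scalerDl presented_piD.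
Qed.

HB.instance Definition _ := GRing.Zmodule_isLmodule.Build k presented
  presented_scaleA presented_scale1 presented_scaleDr presented_scaleDl.

End Presented.

HB.lock Definition pgen (k : fieldType) (X : choiceType)
    (rels : set {malg k[X]}) (x : X) : presented rels :=
  \pi_(presented rels) << x >>.
Canonical pgen_unlockable := Unlockable pgen.unlock.

Section PresentedTheory.
Variables (k : fieldType) (X : choiceType) (rels : set {malg k[X]}).
Local Notation presented := (presented rels).
Local Notation pgen := (pgen rels).

Lemma pgen_rel c x y z :
  rels (<< x >> - (c *: << y >> + << z >>)) -> pgen x = c *: pgen y + pgen z.
Proof.
move=> rxyz; have -> : c *: pgen y = \pi_presented (c *: << y >>).
  by rewrite unlock (pi_presented_scale _ c).
rewrite unlock -presented_piD.
apply/eqP; rewrite -Quotient.idealrBE.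
by apply/asboolP; apply: lspan_sub.
Qed.

Section Lift.
Variables (V : lmodType k) (f : X -> V).

Definition flift (g : {malg k[X]}) : V := \sum_(x <- msupp g) g@_x *: f x.

Lemma fliftEw g (d : {fset X}) : (msupp g `<=` d)%fset ->
  flift g = \sum_(x <- d) g@_x *: f x.
Proof.
move=> le_gd; rewrite /flift; apply: big_fset_incl => // x _ xNg.
by rewrite mcoeff_outdom // scale0r.
Qed.

Fact flift_linear : linear flift.
Proof.
move=> c x y; have ledx := fsubsetUl (msupp x) (msupp y).
have ledy := fsubsetUr (msupp x) (msupp y).
have led : (msupp (c *: x + y) `<=` msupp x `|` msupp y)%fset.
  by rewrite (fsubset_trans (msuppD_le _ _)) // fsetSU // msuppZ_le.
rewrite (fliftEw ledx) (fliftEw ledy) (fliftEw led) scaler_sumr -big_split /=.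
by apply: eq_bigr => i _; rewrite mcoeffD mcoeffZ scalerDl scalerA.
Qed.

Lemma fliftU x : flift << x >> = f x.
Proof. by rewrite (fliftEw msuppU_le) big_seq_fset1 mcoeffUU scale1r. Qed.

HB.instance Definition _ := GRing.isLinear.Build k {malg k[X]} V *:%R flift
  flift_linear.

Lemma flift_rel c x y z :
  f x = c *: f y + f z -> flift (<< x >> - (c *: << y >> + << z >>)) = 0.
Proof. by move=> fx; rewrite raddfB /= flift_linear !fliftU fx subrr. Qed.

Definition respects := forall g, rels g -> flift g = 0.

Definition plift_fun (v : presented) : V := flift (repr v).

Hypothesis fR : respects.

Lemma plift_pi g : plift_fun (\pi g) = flift g.
Proof.
apply/eqP; rewrite eq_sym -subr_eq0 -raddfB.
suff: forall h, lspan rels h -> flift h = 0.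
  by move=> H; apply/eqP; apply: H; exact: relspan_repr.
move=> h; elim=> [|c x y /fR x0 _ IH]; first exact: raddf0.
by rewrite flift_linear x0 IH scaler0 addr0.
Qed.

Fact plift_linear : linear plift_fun.
Proof.
move=> c u v; rewrite -[u]reprK -[v]reprK.
rewrite -[c *: _](pi_presented_scale _ c) -presented_piD.
by rewrite !plift_pi flift_linear.
Qed.

End Lift.

Fact plift_exists (V : lmodType k) (f : X -> V) (fR : respects f) :
  {h : {linear presented -> V} | forall x, h (pgen x) = f x}.
Proof.
exists (HB.pack_for {linear presented -> V} (plift_fun f)
  (GRing.isLinear.Build k presented V *:%R (plift_fun f) (plift_linear fR))).
by move=> x; rewrite /= unlock plift_pi // fliftU.
Qed.

(* The linear map with the given values on generators; unique by plin_ext.    *)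
Definition plift (V : lmodType k) (f : X -> V) (fR : respects f) :
    {linear presented -> V} := sval (plift_exists fR).

Lemma pliftE (V : lmodType k) (f : X -> V) (fR : respects f) x :
  plift fR (pgen x) = f x.
Proof. exact: (svalP (plift_exists fR)). Qed.

Lemma presented_ind (P : presented -> Prop) :
  P 0 -> (forall c x v, P v -> P (c *: pgen x + v)) -> forall v, P v.
Proof.
move=> P0 PD v; rewrite -[v]reprK [repr v]monalgE.
elim: (msupp _ : seq X) => [|x s IH].
  by rewrite big_nil presented_pi0.
rewrite big_cons presented_piD; set c := _@_x.
have -> : << c *g x >> = c *: << x >> :> {malg k[X]}.
  by apply/malgP => y; rewrite mcoeffZ !mcoeffU mulrnAr mulr1.
by rewrite (pi_presented_scale _ c); have := PD c x; rewrite unlock; apply.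
Qed.

Lemma plin_ext (V : lmodType k) (f g : {linear presented -> V}) :
  (forall x, f (pgen x) = g (pgen x)) -> f =1 g.
Proof.
move=> fg; elim/presented_ind => [|c x v IH]; first by rewrite !raddf0.
by rewrite !linearP fg IH.
Qed.

End PresentedTheory.

Section Tensor.
Variables (k : fieldType) (U V : lmodType k).

Definition bilin_rels : set {malg k[(U * V)%type]} := [set g |
  (exists c u u' v,
     g = << (c *: u + u', v) >> - (c *: << (u, v) >> + << (u', v) >>)) \/
  (exists c u v v',
     g = << (u, c *: v + v') >> - (c *: << (u, v) >> + << (u, v') >>))].

Definition tensor := presented bilin_rels.
HB.instance Definition _ := GRing.Lmodule.on tensor.

Definition tens (u : U) (v : V) : tensor := pgen bilin_rels (u, v).

Fact tens_linl v : linear (tens^~ v).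
Proof. by move=> c u u'; apply: pgen_rel; left; exists c, u, u', v. Qed.

Fact tens_linr u : linear (tens u).
Proof. by move=> c v v'; apply: pgen_rel; right; exists c, u, v, v'. Qed.

Section TensorLift.
Variables (W : lmodType k) (f : U -> V -> W).
Hypotheses (fl : forall v, linear (f^~ v)) (fr : forall u, linear (f u)).

Fact tensor_respects : respects bilin_rels (fun uv => f uv.1 uv.2).
Proof.
by move=> _ [[c [u [u' [v ->]]]] | [c [u [v [v' ->]]]]]; apply: flift_rel;
  rewrite /= ?fr //; apply: fl.
Qed.

Definition tensor_lift : {linear tensor -> W} := plift tensor_respects.

Lemma tensor_liftE u v : tensor_lift (tens u v) = f u v.
Proof. exact: pliftE. Qed.

End TensorLift.

End Tensor.

Section TensorMap.
Variables (k : fieldType) (U V U' V' : lmodType k).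
Variables (f : {linear U -> U'}) (g : {linear V -> V'}).

Fact tensor_map_linl v : linear (fun u => tens (f u) (g v)).
Proof. by move=> c u u'; rewrite linearP tens_linl. Qed.

Fact tensor_map_linr u : linear (fun v => tens (f u) (g v)).
Proof. by move=> c v v'; rewrite linearP tens_linr. Qed.

Definition tensor_map : {linear tensor U V -> tensor U' V'} :=
  tensor_lift tensor_map_linl tensor_map_linr.

Lemma tensor_mapE u v : tensor_map (tens u v) = tens (f u) (g v).
Proof. exact: tensor_liftE. Qed.

End TensorMap.

Section AlgebraProduct.
Variables (k : fieldType) (A : algType k).

Fact mulr_linl (y : A) : linear ( *%R^~ y).
Proof. by move=> c x x'; rewrite mulrDl scalerAl. Qed.

Fact mulr_linr (x : A) : linear ( *%R x).
Proof. by move=> c y y'; rewrite mulrDr scalerAr. Qed.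

Definition mA : {linear tensor A A -> A} := tensor_lift mulr_linl mulr_linr.

Lemma mAE x y : mA (tens x y) = x * y.
Proof. exact: tensor_liftE. Qed.

End AlgebraProduct.

Section Stuffle.
Variables (k : fieldType) (A : algType k).
Implicit Types (a b : seq A) (x y : A) (c : k).

(* Multilinearity in the letters; as no relation changes the length of a word *)
(* the quotient below is the direct sum over n of the tensor powers of A.     *)
Definition multilin_rels : set {malg k[seq A]} := [set g |
  exists s t c x y, g = << s ++ (c *: x + y) :: t >>
                        - (c *: << s ++ x :: t >> + << s ++ y :: t >>)].

Definition stuffle := presented multilin_rels.
HB.instance Definition _ := GRing.Lmodule.on stuffle.

(* word [:: a_1; ...; a_r] is a_1 (x) ... (x) a_r, and word [::] is the unit. *)
Definition word (a : seq A) : stuffle := pgen multilin_rels a.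

Definition multilinear (V : lmodType k) (f : seq A -> V) := forall s t c x y,
  f (s ++ (c *: x + y) :: t) = c *: f (s ++ x :: t) + f (s ++ y :: t).

Fact word_multilinear : multilinear word.
Proof. by move=> s t c x y; apply: pgen_rel; exists s, t, c, x, y. Qed.

Section WordLift.
Variables (V : lmodType k) (f : seq A -> V) (fM : multilinear f).

Fact multilinear_respects : respects multilin_rels f.
Proof. by move=> _ [s [t [c [x [y ->]]]]]; apply: flift_rel. Qed.

Definition word_lift : {linear stuffle -> V} := plift multilinear_respects.

Lemma word_liftE a : word_lift (word a) = f a.
Proof. exact: pliftE. Qed.

End WordLift.

Fact rcons_multilinear x : multilinear (fun a => word (rcons a x)).
Proof.
by move=> s t c y z; rewrite !rcons_cat !rcons_cons word_multilinear.
Qed.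

(* v |-> v (x) x, concatenation of one letter on the right.                   *)
Definition snoc x : {linear stuffle -> stuffle} :=
  word_lift (rcons_multilinear x).

Lemma snocE a x : snoc x (word a) = word (rcons a x).
Proof. exact: word_liftE. Qed.

Fact snoc_linear c x y (v : stuffle) :
  snoc (c *: x + y) v = c *: snoc x v + snoc y v.
Proof.
elim/presented_ind: v => [|d a v IH].
  by rewrite !raddf0 addr0.
rewrite !linearP IH -/(word a) !snocE -!cats1 word_multilinear.
by rewrite !scalerDr !scalerA mulrC addrACA.
Qed.

(* The recursion of the stuffle product goes through last letters, hence runs *)
(* here on reversed words.                                                    *)
Fixpoint stuffle_rev (u : seq A) : seq A -> stuffle :=
  fix aux (v : seq A) : stuffle :=
    match u, v with
    | [::], _ => word (rev v)
    | _, [::] => word (rev u)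
    | x :: u', y :: v' => snoc x (stuffle_rev u' v) + snoc y (aux v')
                          + snoc (x * y) (stuffle_rev u' v')
    end.

Definition stuffle_words a b : stuffle := stuffle_rev (rev a) (rev b).

Lemma stuffle_words0l b : stuffle_words [::] b = word b.
Proof. by rewrite /stuffle_words /=; case: (rev b) (revK b) => [|y v] <-. Qed.

Lemma stuffle_words0r a : stuffle_words a [::] = word a.
Proof. by rewrite /stuffle_words; case: (rev a) (revK a) => [|x u] <-. Qed.

Lemma stuffle_words_rcons a x b y :
  stuffle_words (rcons a x) (rcons b y) =
    snoc x (stuffle_words a (rcons b y)) + snoc y (stuffle_words (rcons a x) b)
    + snoc (x * y) (stuffle_words a b).
Proof. by rewrite /stuffle_words !rev_rcons. Qed.

Lemma stuffle_rev0 u : stuffle_rev u [::] = word (rev u).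
Proof. by case: u. Qed.

Lemma stuffle_0rev v : stuffle_rev [::] v = word (rev v).
Proof. by case: v. Qed.

Lemma stuffle_rev_cons x u y v :
  stuffle_rev (x :: u) (y :: v) =
    snoc x (stuffle_rev u (y :: v)) + snoc y (stuffle_rev (x :: u) v)
    + snoc (x * y) (stuffle_rev u v).
Proof. by []. Qed.

Fact word_rev_multilinear : multilinear (fun u => word (rev u)).
Proof.
move=> s t c x y; rewrite !rev_cat !rev_cons !cat_rcons; exact: word_multilinear.
Qed.

#[local] Arguments stuffle_rev : simpl never.

Fact linear_add3 (V : lmodType k) c (p q r p' q' r' : V) :
  (c *: p + p') + (c *: q + q') + (c *: r + r') =
  c *: (p + q + r) + (p' + q' + r').
Proof. by rewrite [X in X + _]addrACA [LHS]addrACA !scalerDr. Qed.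

Fact stuffle_revl v : multilinear (fun u => stuffle_rev u v).
Proof.
move=> s t c x y; elim: s v => [|a s IHs]; elim=> [|b v IHv];
  rewrite ?stuffle_rev0; try exact: word_rev_multilinear.
- rewrite !cat0s in IHv *; rewrite 3!stuffle_rev_cons IHv.
  by rewrite mulrDl -scalerAl (snoc_linear c x y)
    (snoc_linear c (x * b) (y * b)) linearP linear_add3.
- rewrite !cat_cons in IHv *; rewrite 3!stuffle_rev_cons IHv !IHs.
  by rewrite !linearP linear_add3.
Qed.

Fact stuffle_revr u : multilinear (stuffle_rev u).
Proof.
move=> s t c x y; elim: s u => [|b s IHs]; elim=> [|a u IHu];
  rewrite ?stuffle_0rev; try exact: word_rev_multilinear.
- rewrite !cat0s in IHu *; rewrite 3!stuffle_rev_cons IHu.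
  by rewrite mulrDr -scalerAr (snoc_linear c x y)
    (snoc_linear c (a * x) (a * y)) linearP linear_add3.
- rewrite !cat_cons in IHu *; rewrite 3!stuffle_rev_cons IHu !IHs.
  by rewrite !linearP linear_add3.
Qed.

Fact stuffle_wordsl b : multilinear (fun a => stuffle_words a b).
Proof.
move=> s t c x y; rewrite /stuffle_words !rev_cat !rev_cons !cat_rcons.
exact: stuffle_revl.
Qed.

Fact stuffle_wordsr a : multilinear (stuffle_words a).
Proof.
move=> s t c x y; rewrite /stuffle_words !rev_cat !rev_cons !cat_rcons.
exact: stuffle_revr.
Qed.

Fact word_lift_linear (V : lmodType k) (f : seq A -> seq A -> V)
    (fl : forall b, multilinear (f^~ b)) (fr : forall a, multilinear (f a)) v :
  multilinear (fun a => word_lift (fr a) v).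
Proof.
move=> s t c x y; elim/presented_ind: v => [|d b v IH]; cbv beta in *.
  by rewrite !raddf0 addr0.
have E a : word_lift (fr a) (d *: pgen _ b + v) =
    d *: f a b + word_lift (fr a) v by rewrite linearP; congr (_ *: _ + _);
  exact: word_liftE.
rewrite !E IH fl !scalerDr !scalerA mulrC.
exact: addrACA.
Qed.

Definition stuffle_prod (u v : stuffle) : stuffle :=
  word_lift (word_lift_linear stuffle_wordsl stuffle_wordsr v) u.

Fact stuffle_prod_words a b :
  stuffle_prod (word a) (word b) = stuffle_words a b.
Proof. by rewrite /stuffle_prod 2!word_liftE. Qed.

Fact stuffle_prod_linl v : linear (stuffle_prod^~ v).
Proof. by move=> c u u'; rewrite /stuffle_prod linearP. Qed.

Fact stuffle_prod_linr u : linear (stuffle_prod u).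
Proof.
move=> c v v'; rewrite /stuffle_prod.
elim/presented_ind: u => [|d a u IH]; first by rewrite !raddf0 addr0.
have E w : word_lift (word_lift_linear stuffle_wordsl stuffle_wordsr w)
    (d *: pgen _ a + u) = d *: word_lift (stuffle_wordsr a) w
    + word_lift (word_lift_linear stuffle_wordsl stuffle_wordsr w) u.
  by rewrite linearP; congr (_ *: _ + _); exact: word_liftE.
rewrite !E IH linearP !scalerDr !scalerA mulrC.
exact: addrACA.
Qed.

(* The quasi-shuffle product; see stuffle_words_rcons for its recursion.      *)
Definition m_st : {linear tensor stuffle stuffle -> stuffle} :=
  tensor_lift stuffle_prod_linl stuffle_prod_linr.

Lemma m_stE a b : m_st (tens (word a) (word b)) = stuffle_words a b.
Proof. by rewrite /m_st tensor_liftE stuffle_prod_words. Qed.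

Fact counit_multilinear : multilinear (fun a => (nilp a)%:R : k^o).
Proof. by move=> [|z s] t c x y; rewrite /= scaler0 addr0. Qed.

Definition eta_st : {linear stuffle -> k^o} := word_lift counit_multilinear.

(* redcop, redDelta_st: reduced deconcatenation; its value on word [::] is 0. *)
Definition redcop_words a : tensor stuffle stuffle :=
  \sum_(1 <= r < size a) tens (word (take r a)) (word (drop r a)).

Fact redcop_multilinear : multilinear redcop_words.
Proof.
move=> s t c x y; rewrite /redcop_words !size_cat /= scaler_sumr -big_split /=.
apply: eq_bigr => r _; rewrite !take_cat !drop_cat; case: ltnP => [_|le_sr].
  by rewrite word_multilinear tens_linr.
case: (r - size s)%N => [|n] /=; first by rewrite (word_multilinear [::]) tens_linr.
by rewrite word_multilinear tens_linl.
Qed.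

Definition cop_words a : tensor stuffle stuffle :=
  if nilp a then tens (word [::]) (word [::])
  else tens (word a) (word [::]) + tens (word [::]) (word a) + redcop_words a.

Fact cop_multilinear : multilinear cop_words.
Proof.
have nN s x t : nilp (s ++ x :: t) = false by rewrite /nilp size_cat addnS.
move=> s t c x y; rewrite /cop_words !nN redcop_multilinear word_multilinear.
by rewrite tens_linl tens_linr linear_add3.
Qed.

Definition redDelta_st : {linear stuffle -> tensor stuffle stuffle} :=
  word_lift redcop_multilinear.

Definition Delta_st : {linear stuffle -> tensor stuffle stuffle} :=
  word_lift cop_multilinear.

(* (A^st)': the sum of the homogeneous components of positive length.         *)
Definition stuffle_pos : set stuffle :=
  lspan [set v | exists2 a, (0 < size a)%N & v = word a].

End Stuffle.

Section Convolution.
Variables (k : fieldType) (A : algType k).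
Implicit Types (f g : {linear stuffle A -> A}) (B : set A).

Definition conv f g : {linear stuffle A -> A} :=
  mA A \o tensor_map f g \o Delta_st A.

Definition u_alg (c : k^o) : A := c%:A.

Fact u_alg_linear : linear u_alg.
Proof. by move=> c x y; rewrite /u_alg scalerDl scalerA. Qed.

HB.instance Definition _ := GRing.isLinear.Build k k^o A *:%R u_alg u_alg_linear.

Definition conv1 : {linear stuffle A -> A} := u_alg \o eta_st A.

Definition inU f := f (word [::]) = 1.

Definition inUB B f := inU f /\ (forall v, stuffle_pos v -> B (f v)).

Definition character f :=
  inU f /\ (forall u v, f (m_st A (tens u v)) = f u * f v).

Fact letter_map_multilinear : multilinear
  (fun a : seq A => match a with [::] => 1 | [:: x] => x | _ => 0 end).
Proof.
move=> [|z [|z' s]] [|w t] c x y //=; by rewrite scaler0 addr0.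
Qed.

Definition letter_map : {linear stuffle A -> A} :=
  word_lift letter_map_multilinear.

End Convolution.

(* S is a group for op, with unit e; op need not behave well outside S.       *)
Definition group_law (T : Type) (S : set T) (op : T -> T -> T) (e : T) :=
  [/\ S e,
      (forall x y, S x -> S y -> S (op x y)),
      (forall x y z, S x -> S y -> S z -> op x (op y z) = op (op x y) z),
      (forall x, S x -> op e x = x /\ op x e = x) &
      (forall x, S x -> exists y, [/\ S y, op x y = e & op y x = e])].

Section RotaBaxter.
Variables (k : fieldType) (A : algType k).

Definition rota_baxter (p : {linear A -> A}) :=
  (forall x, p (p x) = p x) /\
  (forall x y, p x * p y + p (x * y) = p (x * p y) + p (p x * y)).

Definition pminus (p : {linear A -> A}) : {linear A -> A} := idfun \- p.

Definition bogoliubov (p : {linear A -> A}) (f fbar : {linear stuffle A -> A}) :=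
  inU fbar /\
  (forall v, stuffle_pos v ->
     fbar v = f v - mA A (tensor_map (pminus p) idfun
                           (tensor_map fbar f (redDelta_st A v)))).

Definition birkhoff (p : {linear A -> A}) (f fp fm : {linear stuffle A -> A}) :=
  [/\ inUB (range p) fp, inUB (range (pminus p)) fm & conv fm f = fp].

(* p_-(... p_-(p_-(a_1) a_2) ... a_{r-1}) a_r for x :: s = [:: a_1; ...; a_r]; *)
(* this is a_1 when r = 1.                                                    *)
Definition nested (p : {linear A -> A}) (x : A) (s : seq A) : A :=
  foldl (fun z y => pminus p z * y) x s.

End RotaBaxter.

(* Main.v *)
(* A convolution with the letter map j only sees the last letter:             *)
(* (f * j)(a (x) x) = f(a) x + f(a (x) x). Hence j_- * j = j_+ says that      *)
(* j_-(a (x) x) = - p_-(j_-(a) x) and j_+(a (x) x) = p_+(j_-(a) x), which     *)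
(* determines the pair and gives jbar(a (x) x) = j_-(a) x. With A commutative,*)
(* the recursion of the stuffle product on last letters matches term by term  *)
(* the Rota-Baxter identity of p_-, so j_- is a character by induction; j_+   *)
(* is then a product of two characters.                                       *)
Require Import Defs.
From HB Require Import structures.
From mathcomp Require Import all_boot all_algebra.
From mathcomp Require Import boolp classical_sets.

Set Implicit Arguments.
Unset Strict Implicit.
Unset Printing Implicit Defensive.

Import GRing.Theory.
Local Open Scope ring_scope.


(** Everything is governed by splitting off the last letter: [conv_rcons] reduces a convolution to a
    shorter word, so associativity is an induction on length. For j = [letter_map], the equation j_-
    * j = j_+ reads j_-(a) x = j_+(a x) - j_-(a x), the splitting of j_-(a) x along A_+ and A_-.
    This gives uniqueness ([birkhoff_rcons]), and a left fold realizes the recursion. The closed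
    formula holds because jbar(a x) = - p_-(jbar(a)) x for nonempty a ([bogoliubov_map_nested]). For
    characters, [conv_stuffle] writes a convolution on a stuffle product as a double sum over cuts.
    Commutativity factors it ([conv_mul]), hence closure under products and, by cancellation
    ([conv2_cancel]), under inverses. [birkhoff_minus_character] matches the stuffle recursion with
    the Rota-Baxter identity of p_-. *)

(** The shape of the double sum in [conv_stuffle]: three recursive terms in the interior, a single
    one on the last row or column, and the corner apart. *)
Lemma big_grid_recr (V : nmodType) (F P Q S : nat -> nat -> V) n m :
  (forall i j, (i <= n)%N -> (j <= m)%N -> F i j = P i j + Q i j + S i j) ->
  (forall i, (i <= n)%N -> F i m.+1 = P i m.+1) ->
  (forall j, (j <= m)%N -> F n.+1 j = Q n.+1 j) ->
  \sum_(0 <= i < n.+2) \sum_(0 <= j < m.+2) F i j =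
  \sum_(0 <= i < n.+1) \sum_(0 <= j < m.+2) P i j +
  \sum_(0 <= i < n.+2) \sum_(0 <= j < m.+1) Q i j +
  \sum_(0 <= i < n.+1) \sum_(0 <= j < m.+1) S i j + F n.+1 m.+1.
Proof.
move=> Fin Fr Fb; rewrite [in RHS](big_nat_recr n.+1) //= [LHS]big_nat_recr //=.
rewrite [X in _ + X]big_nat_recr //= addrA; congr (_ + _).
have -> : \sum_(0 <= j < m.+1) F n.+1 j = \sum_(0 <= j < m.+1) Q n.+1 j.
  by apply: eq_big_nat => j /andP[_ /Fb].
rewrite addrA [RHS]addrAC; congr (_ + _).
rewrite -!big_split /=; apply: eq_big_nat => i /andP[_ le_in].
rewrite !(big_nat_recr m.+1) //= Fr // !(addrAC _ (P i m.+1)).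
congr (_ + _); rewrite -!big_split /=; apply: eq_big_nat => j /andP[_ le_jm].
exact: Fin.
Qed.

(** * Convolution on words *)

Section Words.
Variables (k : fieldType) (A : algType k).
Implicit Types (f g h : {linear stuffle A -> A}) (a b : seq A) (x y : A).

Lemma word_ext (V : lmodType k) (f g : {linear stuffle A -> V}) :
  (forall a, f (word a) = g (word a)) -> f = g.
Proof. by move=> fg; apply: linear_ext; apply: plin_ext. Qed.

Lemma conv_word f g a :
  conv f g (word a) =
  \sum_(0 <= i < (size a).+1) f (word (take i a)) * g (word (drop i a)).
Proof.
pose T : {linear _ -> A} := mA A \o tensor_map f g.
have TE u v : T (tens u v) = f u * g v by rewrite /T /= tensor_mapE mAE.
have -> : conv f g (word a) = T (Delta_st A (word a)) by [].
(* The body of [T] is forgotten, so that simplification cannot unfold it. *)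
move: T TE => T TE; rewrite /Delta_st word_liftE /cop_words.
case: a => [|x a]; first by rewrite [LHS]TE big_nat1.
rewrite /nilp /= !linearD linear_sum /=.
rewrite !TE.
rewrite [RHS]big_ltn // [X in _ = _ + X]big_nat_recr //= take_size drop_size -addrA addrC -addrA.
by congr (_ + (_ + _)); apply: eq_bigr => i _; rewrite TE.
Qed.

(* Opaque, as /= would otherwise unfold every value of a convolution.         *)
#[local] Opaque conv.

Lemma conv_nil f g : conv f g (word [::]) = f (word [::]) * g (word [::]).
Proof. by rewrite conv_word big_nat1. Qed.

(** Either the cut leaves [x] on the right, where [g \o snoc x] absorbs it, or the right part is
    empty. *)
Lemma conv_rcons f g a x :
  conv f g (word (rcons a x)) =
  conv f (g \o snoc x) (word a) + f (word (rcons a x)) * g (word [::]).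
Proof.
rewrite !conv_word size_rcons big_nat_recr //=.
rewrite -(size_rcons a x) take_size drop_size; congr (_ + _).
rewrite size_rcons; apply: eq_big_nat => i /andP[_]; rewrite ltnS => le_ia.
by rewrite drop_rcons // -cats1 takel_cat // /= snocE.
Qed.

Lemma conv_snoc f g x (v : stuffle A) :
  conv f g (snoc x v) =
  conv f (g \o snoc x) v + f (snoc x v) * g (word [::]).
Proof.
elim/presented_ind: v => [|c a v IH]; first by rewrite !raddf0 mul0r addr0.
rewrite !linearP IH mulrDl -scalerAl addrACA; congr (_ + _).
by rewrite -scalerDr -/(word a) snocE conv_rcons.
Qed.

(** The induction generalizes [h], since splitting off [x] replaces it by [h \o snoc x]. *)
Lemma convA f g h : conv f (conv g h) = conv (conv f g) h.
Proof.
apply: word_ext => a; elim/last_ind: a h => [|a x IH] h.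
  by rewrite !conv_nil mulrA.
rewrite !conv_rcons -IH conv_nil mulrDl mulrA addrA; congr (_ + _).
rewrite !(conv_word f) mulr_suml -big_split; apply: eq_bigr => i _.
by rewrite /= conv_snoc mulrDr mulrA.
Qed.

Lemma conv1_word a : conv1 A (word a) = (nilp a)%:R.
Proof.
by rewrite /conv1 /= /eta_st word_liftE /u_alg; case: nilp; rewrite ?scale1r ?scale0r.
Qed.

#[local] Opaque conv1.

Lemma conv1_snoc x (v : stuffle A) : conv1 A (snoc x v) = 0.
Proof.
elim/presented_ind: v => [|c a v IH]; first by rewrite !raddf0.
by rewrite !linearP IH -/(word a) snocE conv1_word /nilp size_rcons scaler0 addr0.
Qed.

Lemma conv1_nil : conv1 A (word [::]) = 1.
Proof. by rewrite conv1_word. Qed.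

Lemma conv1f f : conv (conv1 A) f = f.
Proof.
apply: word_ext => a; elim/last_ind: a f => [|a x IH] f.
  by rewrite conv_nil conv1_word mul1r.
by rewrite conv_rcons IH conv1_word /nilp size_rcons mul0r addr0 /= snocE.
Qed.

Lemma convf1 f : conv f (conv1 A) = f.
Proof.
apply: word_ext => a; elim/last_ind: a => [|a x _].
  by rewrite conv_nil conv1_word mulr1.
rewrite conv_rcons conv_word big1 ?add0r ?conv1_word ?mulr1 // => i _.
by rewrite /= conv1_snoc mulr0.
Qed.

Lemma convDl f f' g : conv (f \+ f') g =1 conv f g \+ conv f' g.
Proof.
apply: plin_ext => a; rewrite -/(word a) /= !conv_word -big_split /=.
by apply: eq_bigr => i _; rewrite mulrDl.
Qed.

(** * Convolution inverses *)

Section ConvInverse.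
Variables (f : {linear stuffle A -> A}) (f1 : inU f).

(* The right inverse of f is the fixed point of this map, whose value on a    *)
(* word depends on values of g on strictly shorter words only, as f 1 = 1.    *)
Definition conv_inv_step g : {linear stuffle A -> A} :=
  conv1 A \+ conv (conv1 A \- f) g.

Lemma conv_inv_step_eq n g g' a :
  (forall b, (size b < n)%N -> g (word b) = g' (word b)) -> (size a <= n)%N ->
  conv_inv_step g (word a) = conv_inv_step g' (word a).
Proof.
move=> gg' le_an; rewrite /conv_inv_step /= !conv_word; congr (_ + _).
(* The cut at 0 is the only one where [g] sees all of [a]; its coefficient 1 - f(1) vanishes. *)
rewrite !(@big_ltn _ _ _ 0) //= take0 f1 conv1_word subrr !mul0r; congr (_ + _).
apply: eq_big_nat => -[|i] // /andP[_ lt_ia]; congr (_ * _); apply: gg'.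
by rewrite size_drop (leq_trans _ le_an) // ltn_subrL; case: (a) lt_ia.
Qed.

Lemma conv_inv_iter n m a : (size a <= n)%N -> (size a <= m)%N ->
  iter n conv_inv_step (conv1 A) (word a) = iter m conv_inv_step (conv1 A) (word a).
Proof.
wlog le_nm : n m / (n <= m)%N => [H le_an le_am|].
  by case/orP: (leq_total n m) => le; [|symmetry]; exact: H.
elim: n m a le_nm => [|n IH] m a le_nm le_an _.
  have -> : a = [::] by case: a le_an.
  by case: m {le_nm} => [|m] //=; rewrite conv_nil /= f1 conv1_word subrr mul0r addr0.
case: m le_nm => // m le_nm.
rewrite !iterS; apply: (@conv_inv_step_eq n.+1) => // b le_bn.
by apply: IH => //; exact: leq_trans le_bn le_nm.
Qed.

(** The number of iterations depends on the length alone, so the three words of a relation go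
    through the same linear map. *)
Fact conv_inv_multilinear :
  multilinear (fun a => iter (size a) conv_inv_step (conv1 A) (word a)).
Proof. by move=> s t c x y; rewrite !size_cat /= word_multilinear linearP. Qed.

Definition conv_inv : {linear stuffle A -> A} := word_lift conv_inv_multilinear.

Lemma conv_inv_fix : conv_inv = conv_inv_step conv_inv.
Proof.
apply: word_ext => a; rewrite {1}/conv_inv word_liftE.
rewrite (@conv_inv_iter _ (size a).+1) // iterS.
apply: (@conv_inv_step_eq (size a)) => // b lt_ba.
by rewrite /conv_inv word_liftE; apply: conv_inv_iter => //; exact: ltnW.
Qed.

Lemma conv_inv_unit : inU conv_inv.
Proof. by rewrite /inU /conv_inv word_liftE /= conv1_word. Qed.

Lemma conv_invr : conv f conv_inv = conv1 A.
Proof.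
apply: linear_ext => v.
have := congr1 (fun h : {linear stuffle A -> A} => h v) conv_inv_fix.
have := convDl (conv1 A \- f) f conv_inv v.
have -> : (conv1 A \- f) \+ f = conv1 A :> {linear stuffle A -> A}.
  by apply: linear_ext => w /=; rewrite subrK.
rewrite conv1f /= => E1 E2; apply/(addrI (conv (conv1 A \- f) conv_inv v)).
by rewrite -E1 addrC -E2.
Qed.

End ConvInverse.

(** The right inverse of f has a right inverse too, which by associativity must be f. *)
Lemma conv_invl f (f1 : inU f) : conv (conv_inv f) f = conv1 A.
Proof.
have fg := conv_invr f1; have gh := conv_invr (conv_inv_unit f).
suff E : f = conv_inv (conv_inv f) by rewrite [X in conv _ X]E.
by rewrite -[LHS]convf1 -gh convA fg conv1f.
Qed.

(** * Convolution and the stuffle product *)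

(* Dual form of the fact that deconcatenation is a morphism for the stuffle.  *)
Lemma conv_stuffle f g a b :
  conv f g (stuffle_words a b) =
  \sum_(0 <= i < (size a).+1) \sum_(0 <= j < (size b).+1)
    f (stuffle_words (take i a) (take j b)) *
    g (stuffle_words (drop i a) (drop j b)).
Proof.
elim/last_ind: a b g => [|a x IHa] b g.
  rewrite big_nat1 stuffle_words0l conv_word.
  by apply: eq_bigr => j _; rewrite !stuffle_words0l.
elim/last_ind: b g => [|b y IHb] g.
  rewrite stuffle_words0r conv_word; apply: eq_bigr => i _.
  by rewrite big_nat1 !stuffle_words0r.
have take_rc c z i : (i <= size c)%N -> take i (rcons c z) = take i c.
  by move=> le_i; rewrite -cats1 takel_cat.
have take_full c z : take (size c).+1 (rcons c z) = rcons c z.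
  by rewrite -(size_rcons c z) take_size.
have drop_full c z : drop (size c).+1 (rcons c z) = [::].
  by rewrite -(size_rcons c z) drop_size.
rewrite stuffle_words_rcons !linearD !conv_snoc /= IHb !IHa !size_rcons.
(* The three grids apply the stuffle recursion to the right-hand factor; at the corner it applies to
   the left-hand one. *)
rewrite (@big_grid_recr _ _
  (fun i j => f (stuffle_words (take i a) (take j (rcons b y))) *
     g (snoc x (stuffle_words (drop i a) (drop j (rcons b y)))))
  (fun i j => f (stuffle_words (take i (rcons a x)) (take j b)) *
     g (snoc y (stuffle_words (drop i (rcons a x)) (drop j b))))
  (fun i j => f (stuffle_words (take i a) (take j b)) *
     g (snoc (x * y) (stuffle_words (drop i a) (drop j b))))).
- rewrite !take_full !drop_full stuffle_words0l stuffle_words_rcons !linearD.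
  by rewrite !mulrDl [X in X + _ = _]addrACA [LHS]addrACA.
- move=> i j le_ia le_jb; rewrite !take_rc // !drop_rcons //.
  by rewrite stuffle_words_rcons !linearD !mulrDr.
- move=> i le_ia; rewrite take_full drop_full take_rc // drop_rcons //.
  by rewrite !stuffle_words0r snocE.
- move=> j le_jb; rewrite take_full drop_full take_rc // drop_rcons //.
  by rewrite !stuffle_words0l snocE.
Qed.

Lemma characterP f : character f <->
  inU f /\ forall a b, f (stuffle_words a b) = f (word a) * f (word b).
Proof.
split=> -[f1 fM]; split=> //; first by move=> a b; rewrite -m_stE fM.
move=> u v; rewrite /m_st tensor_liftE.
elim/presented_ind: u => [|c a u IHu]; first by rewrite /stuffle_prod !raddf0 mul0r.
rewrite stuffle_prod_linl !linearP IHu mulrDl -scalerAl; congr (_ *: _ + _).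
rewrite -/(word a) /stuffle_prod word_liftE.
elim/presented_ind: v {IHu} => [|d b v IHv]; first by rewrite !raddf0 mulr0.
rewrite !linearP IHv mulrDr -scalerAr -/(word b); congr (_ *: _ + _).
by rewrite word_liftE.
Qed.

Lemma conv1_character : character (conv1 A).
Proof.
apply/characterP; split; first exact: conv1_nil.
elim/last_ind=> [|a x _] b; first by rewrite stuffle_words0l conv1_nil mul1r.
elim/last_ind: b => [|b y _]; first by rewrite stuffle_words0r conv1_nil mulr1.
by rewrite stuffle_words_rcons !linearD !conv1_snoc -snocE conv1_snoc mul0r !addr0.
Qed.

Lemma letter_map_word0 : letter_map A (word [::]) = 1.
Proof. exact: word_liftE. Qed.

Lemma letter_map_snoc x (v : stuffle A) :
  letter_map A (snoc x v) = conv1 A v * x.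
Proof.
elim/presented_ind: v => [|c a v IH]; first by rewrite !raddf0 mul0r.
rewrite !linearP IH mulrDl; congr (_ + _); rewrite -/(word a) snocE conv1_word.
rewrite -scalerAl; congr (_ *: _); rewrite /letter_map word_liftE.
by case: a => [|y [|z a]]; rewrite ?mul1r ?mul0r.
Qed.

(** Of the three stuffle terms only the contracted one, ending in [x * y], can have length one. *)
Lemma letter_map_character : character (letter_map A).
Proof.
have [_ eM] := iffLR (characterP _) conv1_character.
apply/characterP; split; first exact: letter_map_word0.
elim/last_ind=> [|a x _] b; first by rewrite stuffle_words0l letter_map_word0 mul1r.
elim/last_ind: b => [|b y _].
  by rewrite stuffle_words0r letter_map_word0 mulr1.
rewrite stuffle_words_rcons !linearD !letter_map_snoc !eM -!snocE !conv1_snoc.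
rewrite !letter_map_snoc mulr0 !mul0r !add0r !conv1_word.
by case: nilp; case: nilp; rewrite ?mul1r ?mul0r ?mulr0 //.
Qed.

(** [letter_map A \o snoc x] is the counit followed by right multiplication by [x], and the counit
    is a unit for convolution. *)
Lemma conv_letter_map f x (v : stuffle A) :
  conv f (letter_map A) (snoc x v) = f v * x + f (snoc x v).
Proof.
rewrite conv_snoc letter_map_word0 mulr1; congr (_ + _).
elim/presented_ind: v => [|c a v IH]; first by rewrite !raddf0 mul0r.
rewrite !linearP IH mulrDl -scalerAl; congr (_ *: _ + _); rewrite -/(word a).
rewrite -[in RHS](convf1 f) !conv_word mulr_suml; apply: eq_bigr => i _ /=.
by rewrite letter_map_snoc mulrA.
Qed.

(** Induction on total length: the cut at (0, 0) isolates [G a b], and all other cuts involve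
    shorter pairs. *)
Lemma conv2_cancel (F G H : seq A -> seq A -> A) : F [::] [::] = 1 ->
  (forall a b,
     \sum_(0 <= i < (size a).+1) \sum_(0 <= j < (size b).+1)
       F (take i a) (take j b) * G (drop i a) (drop j b) =
     \sum_(0 <= i < (size a).+1) \sum_(0 <= j < (size b).+1)
       F (take i a) (take j b) * H (drop i a) (drop j b)) ->
  forall a b, G a b = H a b.
Proof.
move=> F1 FGH a b; have [n] := ubnP (size a + size b)%N.
elim: n a b => // n IH a b; rewrite ltnS => le_n.
have := FGH a b; rewrite !(@big_ltn _ _ _ 0) // !take0 !drop0 F1 !mul1r.
set G0 := \sum_(1 <= i < _) _; set G1 := \sum_(1 <= i < _) _.
set H0 := \sum_(1 <= i < _) _; set H1 := \sum_(1 <= i < _) _.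
have -> : H0 = G0.
  apply: eq_big_nat => j /andP[j0 le_j]; rewrite IH //.
  by rewrite (leq_trans _ le_n) // ltn_add2l size_drop ltn_subrL j0 (leq_trans j0).
have -> : H1 = G1.
  apply: eq_big_nat => i /andP[i0 le_i]; apply: eq_big_nat => j _; rewrite IH //.
  rewrite (leq_trans _ le_n) // -addSn leq_add // size_drop ?leq_subr //.
  by rewrite ltn_subrL i0 (leq_trans i0).
by move/addIr/addIr.
Qed.

(** * The group of characters *)

Section Commutative.
Hypothesis mulC : commutative ( *%R : A -> A -> A).

(** Commutativity enters the group structure here, to exchange the two middle factors. *)
Lemma conv_mul f g a b :
  \sum_(0 <= i < (size a).+1) \sum_(0 <= j < (size b).+1)
    (f (word (take i a)) * f (word (take j b))) *
    (g (word (drop i a)) * g (word (drop j b))) =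
  conv f g (word a) * conv f g (word b).
Proof.
rewrite !conv_word big_distrlr /=; apply: eq_bigr => i _; apply: eq_bigr => j _.
by rewrite -!mulrA; congr (_ * _); rewrite !mulrA (mulC (f _)).
Qed.

Lemma conv_character f g : character f -> character g -> character (conv f g).
Proof.
move=> /characterP[f1 fM] /characterP[g1 gM]; apply/characterP; split.
  by rewrite /inU conv_nil f1 g1 mulr1.
move=> a b; rewrite conv_stuffle -conv_mul.
by apply: eq_bigr => i _; apply: eq_bigr => j _; rewrite fM gM.
Qed.

(* Both sides of the morphism identity for the inverse of f are right         *)
(* convolution inverses of (a, b) |-> f (a * b) on pairs of words.            *)
Lemma conv_inv_character f : character f -> character (conv_inv f).
Proof.
move=> /characterP[f1 fM]; have [_ eM] := iffLR (characterP _) conv1_character.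
apply/characterP; split; first exact: conv_inv_unit.
apply: (@conv2_cancel (fun a b => f (stuffle_words a b))) => [|a b].
  by rewrite stuffle_words0l.
rewrite -conv_stuffle conv_invr // eM -(conv_invr f1) -conv_mul.
by apply: eq_bigr => i _; apply: eq_bigr => j _; rewrite fM.
Qed.

Lemma character_group : group_law (@character k A) (@conv k A) (@conv1 k A).
Proof.
split=> [||f g h _ _ _|f _|f fC]; first exact: conv1_character.
- exact: conv_character.
- exact: convA.
- by rewrite conv1f convf1.
- have [f1 _] := fC; exists (conv_inv f).
  by rewrite conv_invr // conv_invl //; split=> //; exact: conv_inv_character.
Qed.

End Commutative.

End Words.

(** * Uniqueness of the decomposition and of the Bogoliubov map *)

Section Birkhoff.
Variables (k : fieldType) (A : algType k) (p : {linear A -> A}).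
Implicit Types (f g : {linear stuffle A -> A}) (a s : seq A) (x y : A).

Lemma stuffle_pos_word a : (0 < size a)%N -> stuffle_pos (word a).
Proof. by move=> a0; apply: lspan_sub; exists a. Qed.

Lemma stuffle_pos_range (q : {linear A -> A}) f :
  (forall a x, range q (f (word (rcons a x)))) ->
  forall v, stuffle_pos v -> range q (f v).
Proof.
move=> fq v; elim=> [|c _ u [a a0 ->] _ [y _ qy]].
  by exists 0 => //; rewrite !raddf0.
case/lastP: a a0 => // a x _; have [z _ qz] := fq a x.
by exists (c *: z + y) => //; rewrite !linearP qz qy.
Qed.

(** Applying [p] to fm(a) x + fm(a x) = fp(a x) kills the term in A_- and fixes the one in A_+. *)
Lemma birkhoff_rcons fp fm : (forall x, p (p x) = p x) ->
  birkhoff p (letter_map A) fp fm -> forall a x,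
  fp (word (rcons a x)) = p (fm (word a) * x) /\
  fm (word (rcons a x)) = - pminus p (fm (word a) * x).
Proof.
move=> pp [[fp1 fpP] [fm1 fmP] E] a x.
have ax0 : stuffle_pos (word (rcons a x)).
  by apply: stuffle_pos_word; rewrite size_rcons.
have [y _ py] := fpP _ ax0; have [z _ pz] := fmP _ ax0.
have ppm : p (fm (word (rcons a x))) = 0 by rewrite -pz /= linearB pp subrr.
have {E} : fm (word a) * x + fm (word (rcons a x)) = fp (word (rcons a x)).
  by rewrite -E -snocE conv_letter_map.
have pfp : p (fp (word (rcons a x))) = fp (word (rcons a x)) by rewrite -py pp.
move=> E; have fpE : fp (word (rcons a x)) = p (fm (word a) * x).
  by rewrite -pfp -E linearD ppm addr0.
by split=> //=; rewrite opprB -fpE -E addrAC subrr add0r.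
Qed.

Lemma birkhoff_unique fp fm gp gm : (forall x, p (p x) = p x) ->
  birkhoff p (letter_map A) fp fm -> birkhoff p (letter_map A) gp gm ->
  (fp, fm) = (gp, gm).
Proof.
move=> pp Bf Bg; have [[fp1 _] [fm1 _] Ef] := Bf; have [[gp1 _] [gm1 _] Eg] := Bg.
suff E : fm = gm by rewrite -Ef -Eg E.
apply: word_ext => a; elim/last_ind: a => [|a x IH]; first by rewrite fm1 gm1.
by rewrite (birkhoff_rcons pp Bf a x).2 (birkhoff_rcons pp Bg a x).2 IH.
Qed.

(** [letter_map] vanishes on longer right parts, so only the cut just before [x] survives; a single
    letter has no inner cut. *)
Lemma bogoliubov_letter_rcons g a x :
  mA A (tensor_map (pminus p) idfun
         (tensor_map g (letter_map A) (redDelta_st A (word (rcons a x))))) =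
  if nilp a then 0 else pminus p (g (word a)) * x.
Proof.
rewrite /redDelta_st word_liftE /redcop_words size_rcons !linear_sum /=.
case: a => [|y a]; first by rewrite big_geq.
rewrite big_nat_recr //= big_nat_cond big1 ?add0r; last first.
  move=> i /andP[/andP[_ lt_i] _]; rewrite !tensor_mapE mAE.
  rewrite -rcons_cons drop_rcons ?(ltnW lt_i) // -snocE letter_map_snoc.
  by rewrite conv1_word /nilp size_drop subn_eq0 leqNgt lt_i mul0r mulr0.
rewrite !tensor_mapE mAE drop_rcons // drop_size -cats1 take_size_cat //.
by rewrite -snocE letter_map_snoc conv1_nil mul1r.
Qed.

Lemma bogoliubov_letter f : bogoliubov p (letter_map A) f <->
  inU f /\ forall a x, f (word (rcons a x)) =
    if nilp a then x else - (pminus p (f (word a)) * x).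
Proof.
have E g a x : letter_map A (word (rcons a x)) -
    mA A (tensor_map (pminus p) idfun
      (tensor_map g (letter_map A) (redDelta_st A (word (rcons a x))))) =
    if nilp a then x else - (pminus p (g (word a)) * x).
  rewrite bogoliubov_letter_rcons -snocE letter_map_snoc conv1_word.
  by case: nilp; rewrite ?mul1r ?subr0 // mul0r sub0r.
split=> -[f1 fP]; split=> //.
  by move=> a x; rewrite fP ?E //; apply: stuffle_pos_word; rewrite size_rcons.
(* As one linear map, the right-hand side can be compared with [f] on words only. *)
pose T : {linear stuffle A -> A} := letter_map A \- (mA A \o
  tensor_map (pminus p) idfun \o tensor_map f (letter_map A) \o redDelta_st A).
move=> v v_pos; rewrite -[RHS]/(T v); have {}E a x : T (word (rcons a x)) = _ := E f a x.
move: T E => T E.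
elim: v_pos => [|c _ u [a a0 ->] _ IH]; first by rewrite !raddf0.
rewrite !linearP IH; congr (_ *: _ + _).
by case/lastP: a a0 => // a x _; rewrite fP E.
Qed.

Lemma bogoliubov_letter_unique f g :
  bogoliubov p (letter_map A) f -> bogoliubov p (letter_map A) g -> f = g.
Proof.
move=> /bogoliubov_letter[f1 fP] /bogoliubov_letter[g1 gP].
apply: word_ext => a; elim/last_ind: a => [|a x IH]; first by rewrite f1 g1.
by rewrite fP gP IH.
Qed.

(** * Construction of the decomposition *)

Definition birkhoff_step z x : A := - pminus p (z * x).

Fact birkhoff_step_linl x : linear (birkhoff_step^~ x).
Proof.
move=> c y z; rewrite /birkhoff_step mulrDl -scalerAl linearP opprD.
by rewrite -scalerN.
Qed.

Fact birkhoff_step_linr z : linear (birkhoff_step z).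
Proof.
move=> c x y; rewrite /birkhoff_step mulrDr -scalerAr linearP opprD.
by rewrite -scalerN.
Qed.

Fact birkhoff_step_foldl s : linear (fun z => foldl birkhoff_step z s).
Proof.
elim: s => [|x s IH] c y z //; rewrite [LHS]/= birkhoff_step_linl.
exact: IH.
Qed.

Fact birkhoff_minus_multilinear : multilinear (foldl birkhoff_step 1).
Proof.
move=> s t c x y; rewrite !foldl_cat [LHS]/= birkhoff_step_linr.
exact: birkhoff_step_foldl.
Qed.

Definition birkhoff_minus : {linear stuffle A -> A} :=
  word_lift birkhoff_minus_multilinear.

(** Taken as the product j_- * j, so the decomposition equation holds by definition; what remains is
    that its values lie in A_+. *)
Definition birkhoff_plus : {linear stuffle A -> A} :=
  conv birkhoff_minus (letter_map A).

(* j_+ - j_- = p_+ jbar + p_- jbar = jbar on nonempty words; the counit term  *)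
(* restores the value 1 on the empty word.                                    *)
Definition bogoliubov_map : {linear stuffle A -> A} :=
  birkhoff_plus \- birkhoff_minus \+ conv1 A.

Local Notation jp := birkhoff_plus.
Local Notation jm := birkhoff_minus.
Local Notation jbar := bogoliubov_map.

Lemma birkhoff_minus1 : inU jm.
Proof. by rewrite /inU /jm word_liftE. Qed.

Lemma birkhoff_minus_snoc x (v : stuffle A) :
  jm (snoc x v) = - pminus p (jm v * x).
Proof.
rewrite -/(birkhoff_step _ x); elim/presented_ind: v => [|c a v IH].
  by rewrite !linear0 /birkhoff_step mul0r linear0 oppr0.
rewrite !linearP birkhoff_step_linl IH; congr (_ *: _ + _).
by rewrite -/(word a) snocE /jm !word_liftE foldl_rcons.
Qed.

Lemma birkhoff_plus1 : inU jp.
Proof. by rewrite /inU conv_nil birkhoff_minus1 letter_map_word0 mulr1. Qed.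

Lemma birkhoff_plus_snoc x (v : stuffle A) : jp (snoc x v) = p (jm v * x).
Proof. by rewrite conv_letter_map birkhoff_minus_snoc /= opprB addrC subrK. Qed.

Lemma bogoliubov_map_snoc x (v : stuffle A) : jbar (snoc x v) = jm v * x.
Proof.
rewrite -[LHS]/(jp _ - jm _ + conv1 A _) birkhoff_plus_snoc birkhoff_minus_snoc.
by rewrite conv1_snoc addr0 opprK addrC subrK.
Qed.

Lemma birkhoff_plusE a x :
  jp (word (rcons a x)) = p (jbar (word (rcons a x))).
Proof. by rewrite -snocE birkhoff_plus_snoc bogoliubov_map_snoc. Qed.

Lemma birkhoff_minusE a x :
  jm (word (rcons a x)) = - pminus p (jbar (word (rcons a x))).
Proof. by rewrite -snocE birkhoff_minus_snoc bogoliubov_map_snoc. Qed.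

Lemma bogoliubov_map_nested x s :
  jbar (word (x :: s)) = (-1) ^+ size s * nested p x s.
Proof.
elim/last_ind: s => [|s y IH].
  by rewrite -[[:: x]]/(rcons [::] x) -snocE bogoliubov_map_snoc birkhoff_minus1.
(* [lastI] exhibits [x :: s] as an [rcons], as [birkhoff_minusE] requires. *)
rewrite -rcons_cons -snocE bogoliubov_map_snoc lastI birkhoff_minusE -lastI IH.
rewrite size_rcons /nested foldl_rcons -/(nested p x s) raddfMsign.
by rewrite exprS mulN1r !mulNr mulrA.
Qed.

Lemma bogoliubov_mapP : bogoliubov p (letter_map A) jbar.
Proof.
apply/bogoliubov_letter; split.
  rewrite /inU -[LHS]/(jp _ - jm _ + conv1 A _) birkhoff_plus1 birkhoff_minus1.
  by rewrite subrr add0r conv1_nil.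
move=> a x; rewrite -snocE bogoliubov_map_snoc.
case/lastP: a => [|a y]; first by rewrite birkhoff_minus1 mul1r.
by rewrite /nilp size_rcons birkhoff_minusE mulNr.
Qed.

Lemma birkhoff_letter : birkhoff p (letter_map A) jp jm.
Proof.
split=> //; split.
- exact: birkhoff_plus1.
- by apply: stuffle_pos_range => a x; rewrite birkhoff_plusE; eexists.
- exact: birkhoff_minus1.
- apply: stuffle_pos_range => a x; rewrite birkhoff_minusE -linearN.
  by eexists.
Qed.

(** * The Rota-Baxter identity and characters *)

(** Once expanded, the two sides differ by the same expression for Id - p as for p. *)
Lemma rota_baxter_pminus : rota_baxter p -> rota_baxter (pminus p).
Proof.
move=> [pp pM]; split=> x /= => [|y]; first by rewrite linearB pp subrr subr0.
have pE : p x * p y = p (x * p y) + p (p x * y) - p (x * y) by rewrite -pM addrK.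
rewrite !(mulrBl, mulrBr) pE !linearB /= !opprK -!addrA; congr (_ + (_ + _)).
rewrite addrCA [RHS]addrCA; congr (_ + _).
rewrite [in RHS](addrCA (x * y)) [RHS]addrCA; congr (_ + _).
by rewrite addrC -!addrA.
Qed.

Lemma birkhoff_minus_character : rota_baxter p ->
  commutative ( *%R : A -> A -> A) -> character jm.
Proof.
move=> /rota_baxter_pminus[_ PM] mulC.
apply/characterP; split; first exact: birkhoff_minus1.
elim/last_ind=> [|a x IHa] b; first by rewrite stuffle_words0l birkhoff_minus1 mul1r.
elim/last_ind: b => [|b y IHb]; first by rewrite stuffle_words0r birkhoff_minus1 mulr1.
rewrite stuffle_words_rcons !linearD !birkhoff_minus_snoc IHb !IHa.
rewrite -!snocE !birkhoff_minus_snoc; move: PM; set P := pminus p.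
move: (jm (word a)) (jm (word b)) => u w PM.
(* Commutativity expresses all three stuffle terms through X = [u * x] and Y = [w * y]; they become
   P(X P(Y)), P(P(X) Y) and - P(X Y). *)
have -> : u * - P (w * y) * x = - (u * x * P (w * y)).
  by rewrite mulrN mulNr -!mulrA (mulC x).
have -> : - P (u * x) * w * y = - (P (u * x) * (w * y)).
  by rewrite !mulNr mulrA.
have -> : u * w * (x * y) = u * x * (w * y).
  by rewrite -!mulrA; congr (_ * _); rewrite !mulrA (mulC w).
by rewrite !linearN !opprK -PM addrK mulNr mulrN opprK.
Qed.

End Birkhoff.

Theorem proposition3 (k : fieldType) (A : algType k) (p : {linear A -> A})
    (hp : rota_baxter p) :
  exists jp jm jbar : {linear stuffle A -> A},
  [/\ unique (fun q => birkhoff p (letter_map A) q.1 q.2) (jp, jm),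
      unique (bogoliubov p (letter_map A)) jbar,
      (forall (x : A) (s : seq A),
         jp (word (x :: s)) = p (jbar (word (x :: s))) /\
         p (jbar (word (x :: s))) = (-1) ^+ size s * p (nested p x s)),
      (forall (x : A) (s : seq A),
         jm (word (x :: s)) = - pminus p (jbar (word (x :: s))) /\
         - pminus p (jbar (word (x :: s)))
           = (-1) ^+ (size s).+1 * pminus p (nested p x s)) &
      (commutative ( *%R : A -> A -> A) ->
       [/\ group_law (@character k A) (@conv k A) (@conv1 k A),
           character jp & character jm])].
Proof.
have [pp _] := hp.
exists (birkhoff_plus p), (birkhoff_minus p), (bogoliubov_map p); split.
- split=> [|[gp gm] /= Bg]; first exact: birkhoff_letter.
  by apply: birkhoff_unique Bg => //; exact: birkhoff_letter.
- split=> [|g Bg]; first exact: bogoliubov_mapP.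
  by apply: bogoliubov_letter_unique Bg; exact: bogoliubov_mapP.
- move=> x s; rewrite [x :: s]lastI birkhoff_plusE -lastI bogoliubov_map_nested.
  by rewrite raddfMsign.
- move=> x s; rewrite [x :: s]lastI birkhoff_minusE -lastI bogoliubov_map_nested.
  by rewrite raddfMsign exprS mulN1r mulNr.
- move=> mulC; have jmC := birkhoff_minus_character hp mulC.
  split=> //; first exact: character_group.
  by apply: conv_character => //; exact: letter_map_character.
Qed.
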